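(* For every integer $k\geq 0$, $$\sum_{\iota\in\mathcal{I}_{2k+1}(123)} q^{\mathrm{coinv}(\iota)} = \sum_{j=1}^k q^{2j} A_{2j+1,k-j}(q^2) + \sum_{j=0}^k B_{2j+2,k-j}(q^2).$$
   Context: A permutation $\sigma$ of $[n]$ (one-line notation) contains a pattern $\pi\in\mathfrak{S}_k$ if some subsequence $\sigma(m_1)\cdots\sigma(m_k)$ with $m_1<\dots<m_k$ is in the same relative order as $\pi$; otherwise it avoids $\pi$. $\mathcal{I}_n(\pi)$ is the set of involutions ($\iota^2=\mathrm{id}$) of $[n]$ avoiding $\pi$. $\mathrm{coinv}(\sigma)$ is the number of pairs $i<j$ with $\sigma(i)<\sigma(j)$. For positive integers $m$ and $\ell\ge 0$, $A_{m,\ell}$ is the set of sequences $(a_1,\dots,a_\ell)$ of positive integers such that: (1) $a_1\le m$; (2) if $a_1,\dots,a_i$ are all equal to $1$ then $a_{i+1}\le m+i$; (3) if $a_i\ne 1$ and $a_{i+1},\dots,a_{i+r}$ are all equal to $1$ (for some $r\ge 0$) then $a_{i+r+1}\le a_i+r$. (For $\ell=0$, $A_{m,0}$ consists of the empty sequence.) Let $B_{m,\ell}=\{(a_1,\dots,a_\ell)\in A_{m,\ell}: a_1\neq 1\}$. Define $A_{m,\ell}(q)=\sum_{(a_1,\dots,a_\ell)\in A_{m,\ell}} q^{a_1+\dots+a_\ell-\ell}$ and $B_{m,\ell}(q)$ analogously over $B_{m,\ell}$. *)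

(* Defs.v *)
From mathcomp Require Import all_boot all_order all_algebra all_fingroup.
Set Implicit Arguments.
Unset Strict Implicit.
Unset Printing Implicit Defensive.
Import GRing.Theory.
Local Open Scope ring_scope.

(* [n] = {1, ..., n} is modelled by 'I_n = {0, ..., n - 1}; only the relative
   order of positions and of values matters below. *)
Definition contains (n k : nat) (s : 'S_n) (p : 'S_k) : bool :=
  [exists m : {ffun 'I_k -> 'I_n},
    [forall i : 'I_k, forall j : 'I_k, (i < j)%N ==> (m i < m j)%N] &&
    [forall i : 'I_k, forall j : 'I_k, (s (m i) < s (m j))%N == (p i < p j)%N]].

Definition avoids (n k : nat) (s : 'S_n) (p : 'S_k) : bool := ~~ contains s p.

Definition involutions_avoiding (n k : nat) (p : 'S_k) : {set 'S_n} :=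
  [set s : 'S_n | (s * s == 1)%g & avoids s p].

(* 123 in one-line notation is the identity of 'S_3. *)
Definition pattern123 : 'S_3 := 1%g.

Definition coinv (n : nat) (s : 'S_n) : nat :=
  #|[set ij : 'I_n * 'I_n | (ij.1 < ij.2)%N & (s ij.1 < s ij.2)%N]|.

Definition ones (a : seq nat) : bool := all (pred1 1%N) a.

(* Indices are shifted: nth 0 a i is a_(i+1) in one-based notation, so in the
   last condition the block a_(i+1), ..., a_(i+r) (one-based) is
   take r (drop i.+1 a) (zero-based i). *)
Definition in_A (m : nat) (a : seq nat) : bool :=
  [&& all (leq 1) a,
      (0 < size a)%N ==> (nth 0%N a 0 <= m)%N,
      [forall i : 'I_(size a),
        ones (take i a) ==> (nth 0%N a i <= m + i)%N]
    & [forall i : 'I_(size a), forall r : 'I_(size a),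
        [&& (i + r + 1 < size a)%N, nth 0%N a i != 1%N
          & ones (take r (drop i.+1 a))]
        ==> (nth 0%N a (i + r + 1) <= nth 0%N a i + r)%N]].

Lemma in_A_bound (m : nat) (a : seq nat) (i : nat) :
  in_A m a -> (i < size a)%N -> (nth 0%N a i <= m + i)%N.
Proof.
case/and4P=> _ _ /forallP h2 /forallP h3.
elim/ltn_ind: i => p IH pa.
case: (boolP (ones (take p a))) => [o|no].
  by have := h2 (Ordinal pa); rewrite /= o.
have ex : exists i, (i < p)%N && (nth 0%N a i != 1%N).
  case/allPn: no => x /(nthP 0%N) [i]; rewrite size_take pa => ip <-.
  by rewrite nth_take //= => ni; exists i; rewrite ip ni.
have bd i : (i < p)%N && (nth 0%N a i != 1%N) -> (i <= p)%N.
  by case/andP=> /ltnW.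
case: (ex_maxnP ex bd) => i /andP[ip ni] imax.
have ia := ltn_trans ip pa.
have e : (i + (p - i.+1) + 1 = p)%N by rewrite addn1 -addSn subnKC.
have ra : (p - i.+1 < size a)%N by apply: leq_ltn_trans (leq_subr _ _) pa.
have /forallP/(_ (Ordinal ra)) := h3 (Ordinal ia).
rewrite /= e pa ni /=.
have -> : ones (take (p - i.+1) (drop i.+1 a)).
  apply/(all_nthP 0%N) => j.
  rewrite size_take size_drop ltn_sub2r ?(leq_ltn_trans ip) // => jr.
  rewrite nth_take // nth_drop /=; apply: contraT => nj.
  have jp : (i.+1 + j < p)%N by rewrite -ltn_subRL.
  have := imax (i.+1 + j)%N; rewrite jp nj => /(_ isT).
  by rewrite addSn ltnNge leq_addr.
move=> /= le; apply: leq_trans le _.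
apply: leq_trans (leq_add (IH i ip ia) (leqnn _)) _.
by rewrite -addnA leq_add2l -{2}e leq_addr.
Qed.

(* Entries of a member of A_(m,l) are at most m + l (in_A_bound), so storing
   them in 'I_(m + l).+1 loses nothing; see A_setP. *)
Definition entries (N l : nat) (a : l.-tuple 'I_N) : seq nat :=
  [seq nat_of_ord x | x <- a].

Definition A_set (m l : nat) : {set l.-tuple 'I_(m + l).+1} :=
  [set a : l.-tuple 'I_(m + l).+1 | in_A m (entries a)].

Lemma A_setP (m l : nat) (s : seq nat) :
  reflect (exists2 a, a \in A_set m l & entries a = s)
          ((size s == l) && in_A m s).
Proof.
apply: (iffP andP) => [[/eqP sl sA]|[a]]; last first.
  by rewrite inE => aA <-; rewrite aA size_map size_tuple.
have sz : size (map (@inord (m + l)) s) == l by rewrite size_map sl.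
have e : entries (Tuple sz) = s.
  rewrite /entries /= -map_comp -[RHS]map_id; apply/eq_in_map => x.
  case/(nthP 0%N)=> i il <- /=; rewrite inordK // ltnS.
  by rewrite (leq_trans (in_A_bound sA il)) // leq_add2l -sl ltnW.
by exists (Tuple sz); rewrite // inE e.
Qed.

Lemma entries_inj (N l : nat) : injective (@entries N l).
Proof. by move=> a b /(inj_map val_inj) /val_inj. Qed.

(* The condition a_1 != 1 is vacuous for the empty sequence. *)
Definition B_set (m l : nat) : {set l.-tuple 'I_(m + l).+1} :=
  [set a in A_set m l | (0 < l)%N ==> (nth 0%N (entries a) 0 != 1%N)].

Definition A_poly (m l : nat) : {poly int} :=
  \sum_(a in A_set m l) 'X^(sumn (entries a) - l).

Definition B_poly (m l : nat) : {poly int} :=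
  \sum_(a in B_set m l) 'X^(sumn (entries a) - l).

(* Main.v *)
(* Deleting the 2-cycle through 1 from a 123-avoiding involution which does not
   fix 1 leaves a shorter one.  Conversely, a 2-cycle (1, p) may be inserted iff
   the entries from the insertion point on are decreasing, i.e. iff the number t
   of entries to the right of the new value 1 is at most the length L of the last
   decreasing run.  This adds 2t to coinv, and the last run becomes t if t > 0,
   and L + 1 if t = 0 (or the whole word, if everything was decreasing).  With
   a = t + 1 and m = L + 1 these are the rules defining A_(m,l).  The involutions
   from which nothing is deleted are 1 followed by a decreasing word of length 2j
   (m = 2j + 1, coinv = 2j) and the decreasing word of length 2j + 1 (m = 2j + 2,
   coinv = 0), whose first insertion must not produce a decreasing word: hence
   B instead of A. *)
Require Import Defs.
From mathcomp Require Import all_boot all_order all_algebra all_fingroup.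
From mathcomp Require Import zify.
Set Implicit Arguments.
Unset Strict Implicit.
Unset Printing Implicit Defensive.
Import GRing.Theory.
Local Open Scope ring_scope.

(** * Recurrences on the first entry for [A_poly] and [B_poly] *)

Lemma in_AP (m : nat) (a : seq nat) :
  reflect
    [/\ all (leq 1) a,
        forall i, (i < size a)%N -> ones (take i a) ->
          (nth 0%N a i <= m + i)%N
      & forall i r, (i + r + 1 < size a)%N -> nth 0%N a i != 1%N ->
          ones (take r (drop i.+1 a)) ->
          (nth 0%N a (i + r + 1) <= nth 0%N a i + r)%N]
    (in_A m a).
Proof.
apply: (iffP and4P) => [[pos _ /forallP h2 /forallP h3]|[pos h2 h3]]; split=> //.
- by move=> i ia o; have := h2 (Ordinal ia); rewrite /= o.
- move=> i r ira ni o.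
  have ia : (i < size a)%N by lia.
  have ra : (r < size a)%N by lia.
  by have /forallP/(_ (Ordinal ra)) := h3 (Ordinal ia); rewrite /= ira ni o.
- apply/implyP=> a0; have := h2 0%N a0; rewrite take0 addn0; exact.
- by apply/forallP=> i; apply/implyP=> o; apply: h2.
- apply/forallP=> i; apply/forallP=> r; apply/implyP=> /and3P[ira ni o].
  exact: h3.
Qed.

Lemma in_A_nil (m : nat) : in_A m [::].
Proof. by apply/in_AP; split. Qed.

(** The past of a sequence matters only through one number, the current bound: a leading 1 raises it
    by one, and after a leading [x != 1] rule (3) turns into rules (1) and (2) with [x] in place of
    [m]. *)
Lemma in_A_cons (m x : nat) (a : seq nat) :
  in_A m (x :: a)
  = (0 < x <= m)%N && in_A (if x == 1%N then m.+1 else x) a.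
Proof.
apply/in_AP/andP => [[/= /andP[x0 pos] h2 h3]|[/andP[x0 xm] /in_AP[pos h2 h3]]].
  have xm : (x <= m)%N by have := h2 0%N isT isT; rewrite addn0.
  split; first by rewrite x0.
  apply/in_AP; split=> // [i ia o|i r ira ni o].
    case: eqP => [x1|/eqP x1].
      by have := h2 i.+1 ia; rewrite /= x1 eqxx o => /(_ isT); lia.
    have := h3 0%N i; rewrite /= drop0 add0n addn1 => /(_ ia x1 o); exact.
  exact: (h3 i.+1 r).
split=> [/=|[|i] /= ia|[|i] r /= ira].
- by rewrite x0.
- by rewrite addn0.
- case/andP=> /eqP x1 o; have := h2 i ia o; rewrite x1 eqxx; lia.
- rewrite drop0 add0n addn1 /= => /negPf x1 o.
  have := h2 r; rewrite x1; apply=> //; lia.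
- by move=> ni o; apply: h3.
Qed.

(** Ensures that the truncated subtraction in the exponents is exact. *)
Lemma leq_size_sumn (m : nat) (a : seq nat) :
  in_A m a -> (size a <= sumn a)%N.
Proof. by case/in_AP=> + _ _; elim: a => //= x a IH /andP[x0 /IH]; lia. Qed.

Lemma sum_tuple_cons (R : nmodType) (T : finType) (l : nat)
    (P : pred (l.+1.-tuple T)) (F : l.+1.-tuple T -> R) :
  \sum_(a | P a) F a
  = \sum_x \sum_(a | P (cons_tuple x a)) F (cons_tuple x a).
Proof.
rewrite pair_big_dep /=.
rewrite (reindex (fun p : T * l.-tuple T => cons_tuple p.1 p.2)) //=.
exists (fun a => (thead a, behead_tuple a)) => [[x a] _|a _] /=.
  by rewrite theadE; congr pair; apply: val_inj.
by rewrite [RHS]tuple_eta; apply: val_inj.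
Qed.

(** The alphabet size [N] is decoupled from [m] and [l], since removing the first entry changes both
    while the remaining entries keep their type. *)
Definition A_tuples_sum (N m l : nat) : {poly int} :=
  \sum_(a : l.-tuple 'I_N | in_A m (entries a)) 'X^(sumn (entries a) - l).

Lemma A_polyE (m l : nat) : A_poly m l = A_tuples_sum (m + l).+1 m l.
Proof. by apply: eq_bigl => a; rewrite inE. Qed.

Lemma sum_ord_nat_cond (R : nmodType) (N i m : nat) (F : nat -> R) :
  (m < N)%N ->
  \sum_(x < N | (i <= x <= m)%N) F x = \sum_(i <= x < m.+1) F x.
Proof.
move=> mN; rewrite [RHS](big_nat_widenl _ 0) // [RHS](big_nat_widen _ _ N) //.
by rewrite big_mkord.
Qed.

Lemma A_tuples_sum_cons (N m l : nat) (P : pred nat) : (m < N)%N ->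
  \sum_(a : l.+1.-tuple 'I_N | in_A m (entries a) && P (nth 0%N (entries a) 0))
     'X^(sumn (entries a) - l.+1)
  = \sum_(1 <= x < m.+1 | P x)
      'X^(x.-1) * A_tuples_sum N (if x == 1%N then m.+1 else x) l.
Proof.
move=> mN; rewrite sum_tuple_cons.
rewrite big_mkcond [RHS]big_mkcond -(sum_ord_nat_cond _ _ mN) [RHS]big_mkcond /=.
apply: eq_bigr => x _.
rewrite (eq_bigl (fun a : l.-tuple 'I_N => [&& (0 < x <= m)%N, P x &
    in_A (if x == 1%N :> nat then m.+1 else x) (entries a)])); last first.
  by move=> a; rewrite /= in_A_cons -!andbA; do !bool_congr.
case: (boolP (0 < x <= m)%N) => /= [xm|_]; last by rewrite big_pred0_eq.
case: (boolP (P x)) => /= [Px|_]; last by rewrite big_pred0_eq.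
rewrite big_distrr /=; apply: eq_bigr => a Aa.
rewrite -exprD; congr 'X^_.
have := leq_size_sumn Aa; rewrite size_map size_tuple /=.
rewrite -/(entries a); lia.
Qed.

Lemma A_tuples_sum_succ (N m l : nat) : (m < N)%N ->
  A_tuples_sum N m l.+1
  = \sum_(1 <= x < m.+1)
      'X^(x.-1) * A_tuples_sum N (if x == 1%N then m.+1 else x) l.
Proof.
move=> mN; rewrite -(A_tuples_sum_cons l predT mN).
by apply: eq_bigl => a; rewrite andbT.
Qed.

Lemma A_tuples_sum0 (N m : nat) : A_tuples_sum N m 0 = 1.
Proof.
rewrite /A_tuples_sum (big_pred1 [tuple]) // => a.
by rewrite tuple0 in_A_nil; apply/esym/eqP.
Qed.

(** The recurrence on the first entry mentions [N] only inside the shorter sums, and its new bound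
    plus the new length stays at most [m + l]. *)
Lemma A_tuples_sum_indep (l m N : nat) : (m + l < N)%N ->
  A_tuples_sum N m l = A_poly m l.
Proof.
move=> mN; rewrite A_polyE.
elim: l m N mN => [|l IH] m N mN.
  by rewrite !A_tuples_sum0.
have IH2 M M' k : (k + l < M)%N -> (k + l < M')%N ->
    A_tuples_sum M k l = A_tuples_sum M' k l.
  by move=> h h'; rewrite (IH _ _ h) (IH _ _ h').
rewrite !A_tuples_sum_succ; try lia.
rewrite !big_nat; apply: eq_bigr => x xm.
by congr (_ * _); apply: IH2; case: eqP; lia.
Qed.

Lemma A_poly0 (m : nat) : A_poly m 0 = 1.
Proof. by rewrite A_polyE A_tuples_sum0. Qed.

Lemma B_poly0 (m : nat) : B_poly m 0 = 1.
Proof.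
rewrite /B_poly (big_pred1 [tuple]) // => a.
by rewrite !inE tuple0 in_A_nil; apply/esym/eqP.
Qed.

Lemma B_poly_succ (m l : nat) :
  B_poly m l.+1 = \sum_(2 <= x < m.+1) 'X^(x.-1) * A_poly x l.
Proof.
have mN : (m < (m + l.+1).+1)%N by lia.
have -> : B_poly m l.+1 = \sum_(a : l.+1.-tuple 'I_(m + l.+1).+1
    | in_A m (entries a) && (nth 0%N (entries a) 0 != 1%N))
    'X^(sumn (entries a) - l.+1).
  by apply: eq_bigl => a; rewrite !inE.
rewrite (A_tuples_sum_cons l (fun x => x != 1%N) mN).
rewrite [RHS](big_nat_widenl _ 1) // [LHS]big_nat_cond [RHS]big_nat_cond.
apply: eq_big => [x|x /andP[xm /negPf x1]]; first by lia.
by rewrite x1 A_tuples_sum_indep //; lia.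
Qed.

(** A first entry 1 has weight 1 and raises the bound; all other first entries are counted by
    [B_poly]. *)
Lemma A_poly_succ (m l : nat) : (0 < m)%N ->
  A_poly m l.+1 = A_poly m.+1 l + B_poly m l.+1.
Proof.
move=> m0; rewrite A_polyE A_tuples_sum_succ; last by lia.
rewrite big_ltn // expr0 mul1r A_tuples_sum_indep; last by lia.
rewrite B_poly_succ; congr (_ + _); rewrite !big_nat; apply: eq_bigr => x xm.
have /negPf -> : x != 1%N by lia.
by rewrite A_tuples_sum_indep //; lia.
Qed.

(** * Avoidance of 123, last decreasing runs and coinversions *)

Lemma avoids123P (n : nat) (s : 'S_n) :
  reflect (forall i j k : 'I_n, (i < j < k)%N -> ~~ (s i < s j < s k)%N)
          (avoids s pattern123).
Proof.
apply: (iffP idP) => [av i j k /andP[ij jk]|h].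
  apply: contra av => /andP[sij sjk]; apply/existsP.
  (* The default value [k] serves the remaining index 2. *)
  exists [ffun x : 'I_3 => [fun y : nat => k with 0%N |-> i, 1%N |-> j] x].
  apply/andP; split; apply/forallP=> x; apply/forallP=> y; rewrite !ffunE ?perm1.
    by case: x => [[|[|[|x]]] //= _]; case: y => [[|[|[|y]]] //= _]; lia.
  by case: x => [[|[|[|x]]] //= _]; case: y => [[|[|[|y]]] //= _]; lia.
apply/negP => /existsP[m /andP[/forallP mono /forallP pat]].
pose a : 'I_3 := @Ordinal 3 0 isT.
pose b : 'I_3 := @Ordinal 3 1 isT.
pose c : 'I_3 := @Ordinal 3 2 isT.
have := h (m a) (m b) (m c).
have /forallP/(_ b) /= -> := mono a.
have /forallP/(_ c) /= -> := mono b.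
have /forallP/(_ b) /eqP -> := pat a.
have /forallP/(_ c) /eqP -> := pat b.
by rewrite !perm1 => /(_ isT).
Qed.

Lemma involP (n : nat) (s : 'S_n) :
  reflect (involutive s) (s * s == 1)%g.
Proof.
apply: (iffP eqP) => [ss i|ss]; last by apply/permP=> i; rewrite permM perm1.
by rewrite -permM ss perm1.
Qed.

Definition decreasing_from (n : nat) (s : 'S_n) (p : nat) : bool :=
  [forall i : 'I_n, forall j : 'I_n, (p <= i < j)%N ==> (s j < s i)%N].

Lemma decreasing_fromP (n : nat) (s : 'S_n) (p : nat) :
  reflect (forall i j : 'I_n, (p <= i < j)%N -> (s j < s i)%N)
          (decreasing_from s p).
Proof.
apply: (iffP forallP) => h i; last by apply/forallP=> j; apply/implyP/h.
by move=> j; have /forallP/(_ j)/implyP := h i.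
Qed.

Lemma decreasing_fromW (n : nat) (s : 'S_n) (p q : nat) :
  (p <= q)%N -> decreasing_from s p -> decreasing_from s q.
Proof.
by move=> pq /decreasing_fromP h; apply/decreasing_fromP=> i j ij; apply: h; lia.
Qed.

Definition last_run (n : nat) (s : 'S_n) : nat :=
  \max_(t < n.+1 | decreasing_from s (n - t)) t.

(** A suffix of a decreasing suffix is decreasing, so the maximum is a threshold. *)
Lemma leq_last_run (n : nat) (s : 'S_n) (t : nat) :
  (t <= last_run s)%N = (t <= n)%N && decreasing_from s (n - t).
Proof.
apply/idP/andP => [|[tn dt]]; last first.
  have tn1 : (t < n.+1)%N by [].
  exact: (@leq_bigmax_cond _ _ (fun t : 'I_n.+1 => t : nat) (Ordinal tn1)).
have d0 : decreasing_from s (n - (ord0 : 'I_n.+1)).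
  by apply/decreasing_fromP=> i j /=; have := ltn_ord i; lia.
have [] := @eq_bigmax_cond _ [pred t : 'I_n.+1 | decreasing_from s (n - t)]
  (fun t : 'I_n.+1 => t : nat).
  by apply/card_gt0P; exists ord0.
move=> t0 dt0 e; rewrite /last_run e => tt0; split; first by case: t0 tt0 {dt0 e} => /=; lia.
by apply: decreasing_fromW dt0; lia.
Qed.

Lemma last_run_leq (n : nat) (s : 'S_n) : (last_run s <= n)%N.
Proof. by have := leqnn (last_run s); rewrite {1}leq_last_run => /andP[]. Qed.

Lemma last_run_eq (n : nat) (s : 'S_n) (t : nat) :
  (t <= n)%N -> decreasing_from s (n - t) ->
  ((t < n)%N -> ~~ decreasing_from s (n - t.+1)) -> last_run s = t.
Proof.
move=> tn dt ndt; apply/eqP; rewrite eqn_leq [(t <= _)%N]leq_last_run tn dt !andbT leqNgt.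
by rewrite leq_last_run; apply/negP => /andP[/ndt /negP].
Qed.

Lemma last_run_full (n : nat) (s : 'S_n) :
  (last_run s == n) = decreasing_from s 0.
Proof.
by rewrite eqn_leq last_run_leq leq_last_run leqnn subnn.
Qed.

Lemma coinvE (n : nat) (s : 'S_n) :
  coinv s = (\sum_(i < n) \sum_(j < n) (i < j) && (s i < s j))%N.
Proof.
rewrite /coinv -sum1_card pair_big /= big_mkcond /=.
by apply: eq_bigr => -[i j] _; rewrite inE /=; case: andP.
Qed.

Lemma sum_ord_geq (n c : nat) : (\sum_(k < n) (c <= k) = n - c)%N.
Proof.
by elim: n => [|n IH]; rewrite ?big_ord0 // big_ord_recr /= IH; lia.
Qed.

Lemma sum_ord_ltn (n c : nat) : (c <= n)%N -> (\sum_(k < n) (k < c) = c)%N.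
Proof.
elim: n c => [|n IH] c cn; first by rewrite big_ord0; lia.
rewrite big_ord_recr /=; case: (leqP c n) => cn'; first by rewrite IH // addn0.
have -> : c = n.+1 by lia.
by rewrite (eq_bigr (fun=> 1%N)) ?sum1_card ?card_ord ?addn1 // => i _; rewrite ltnS ltnW.
Qed.

(** Each value of a permutation is its own rank, the number of values below it. *)
Lemma perm_order_inj (n : nat) (u v : 'S_n) :
  (forall i j, (u i < u j)%N = (v i < v j)%N) -> u = v.
Proof.
have rankE (w : 'S_n) i : (w i = \sum_j (w j < w i) :> nat)%N.
  rewrite -{1}(sum_ord_ltn (ltnW (ltn_ord (w i)))).
  by rewrite (reindex_inj (@perm_inj _ w)).
move=> uv; apply/permP=> i; apply/val_inj; rewrite /= rankE [RHS]rankE.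
by apply: eq_bigr => j _; rewrite uv.
Qed.

(** * Insertion of a 2-cycle through the first point *)

Section InsertCycle.

Variables (n : nat) (c : 'I_n.+1).

(** The increasing embedding of the old points that misses [0] and [c + 1]. *)
Definition shift (k : 'I_n) : 'I_n.+2 := lift (lift ord0 c) (lift ord0 k).

(* In zero-based one-line notation: the 2-cycle (0, c + 1) is added to [s], the
   old points being relabelled in increasing order. *)
Definition insert_cycle (s : 'S_n) : 'S_n.+2 :=
  lift_perm ord0 (lift ord0 c) (lift_perm c ord0 s).

Lemma shiftE (k : 'I_n) : (shift k = k.+1 + (c <= k) :> nat)%N.
Proof. by rewrite /= /bump !add1n ltnS addnC. Qed.

Lemma shift_inj : injective shift.
Proof. by move=> i j /lift_inj /lift_inj. Qed.

Lemma ltn_shift (i j : 'I_n) : (shift i < shift j)%N = (i < j)%N.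
Proof. by rewrite !shiftE; lia. Qed.

Lemma shift_liftE (k : 'I_n) : shift k = lift ord0 (lift c k).
Proof. by apply: val_inj; rewrite /= /bump; lia. Qed.

Variant insert_spec (i : 'I_n.+2) : Type :=
  | InsertZero of i = ord0
  | InsertCut of i = lift ord0 c
  | InsertShift k of i = shift k.

Lemma insertP (i : 'I_n.+2) : insert_spec i.
Proof.
case: (unliftP ord0 i) => [j ->|->]; last exact: InsertZero.
case: (unliftP c j) => [k ->|->]; last exact: InsertCut.
by apply: (@InsertShift _ k); rewrite shift_liftE.
Qed.

Lemma big_insert (F : 'I_n.+2 -> nat) :
  (\sum_i F i = F ord0 + F (lift ord0 c) + \sum_k F (shift k))%N.
Proof.
rewrite big_ord_recl (bigD1_ord c) //= addnA; congr (_ + _)%N.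
by apply: eq_bigr => k _; rewrite shift_liftE.
Qed.

Lemma insert_cycle0 (s : 'S_n) : insert_cycle s ord0 = lift ord0 c.
Proof. exact: lift_perm_id. Qed.

Lemma insert_cycle_cut (s : 'S_n) : insert_cycle s (lift ord0 c) = ord0.
Proof. by rewrite lift_perm_lift lift_perm_id; apply: val_inj. Qed.

Lemma insert_cycle_shift (s : 'S_n) (k : 'I_n) :
  insert_cycle s (shift k) = shift (s k).
Proof. by rewrite shift_liftE !lift_perm_lift. Qed.

Definition insert_cycleE :=
  (insert_cycle0, insert_cycle_cut, insert_cycle_shift).

Lemma insert_cycle_invol (s : 'S_n) :
  involutive (insert_cycle s) <-> involutive s.
Proof.
split=> [inv k|inv i]; last by case: (insertP i) => [||k] ->; rewrite !insert_cycleE ?inv.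
by apply: shift_inj; rewrite -!insert_cycle_shift inv.
Qed.

(** The value 0 at position [c + 1] forms a 123 with any ascent to its right. A 123 starting at
    position 0 uses an ascent among values at least [c], which the involution turns into an ascent
    among positions at least [c]. *)
Lemma insert_cycle_avoids (s : 'S_n) : involutive s ->
  avoids (insert_cycle s) pattern123
  = avoids s pattern123 && decreasing_from s c.
Proof.
move=> inv; apply/avoids123P/andP => [av|[/avoids123P av /decreasing_fromP dec]].
  split; first (apply/avoids123P => i j k ijk).
    have := av (shift i) (shift j) (shift k).
    by rewrite !insert_cycleE !ltn_shift; apply.
  apply/decreasing_fromP=> i j ij.
  have := av (lift ord0 c) (shift i) (shift j).
  have : s i != s j by rewrite (inj_eq perm_inj) -val_eqE /=; lia.
  rewrite !insert_cycleE !ltn_shift !shiftE -val_eqE /= /bump; lia.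
move=> i j k.
case: (insertP i) => [||i'] ->; case: (insertP j) => [||j'] ->;
  case: (insertP k) => [||k'] ->; rewrite ?insert_cycleE ?ltn_shift //;
  rewrite ?shiftE /= /bump; try lia.
- move=> jk; apply/negP => sjk.
  by have := dec (s j') (s k'); rewrite !inv; lia.
- by move=> jk; have := dec j' k'; lia.
- by move=> ijk; apply: av.
Qed.

(** The value 0 gains a coinversion with each of the [n - c] old entries to its right, and the first
    entry [c + 1] with each of the [n - c] larger old values; the two new entries form none
    together. *)
Lemma insert_cycle_coinv (s : 'S_n) :
  coinv (insert_cycle s) = (coinv s + 2 * (n - c))%N.
Proof.
rewrite !coinvE big_insert !big_insert !insert_cycleE.
have -> : (\sum_(k < n) \sum_(j < n.+2) ((shift k < j) && (insert_cycle s (shift k) <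
    insert_cycle s j)) = \sum_(i < n) \sum_(j < n) (i < j) && (s i < s j))%N.
  apply: eq_bigr => k _; rewrite big_insert !insert_cycleE /= ltn0 andbF !add0n.
  by apply: eq_bigr => j _; rewrite insert_cycleE !ltn_shift.
have -> : (\sum_(k < n) ((@ord0 n.+1 < shift k) && (lift ord0 c < insert_cycle s (shift k)))
    = n - c)%N.
  rewrite -sum_ord_geq [RHS](reindex_inj (@perm_inj _ s)).
  by apply: eq_bigr => k _; rewrite insert_cycleE !shiftE /= /bump; lia.
have -> : (\sum_(k < n) ((lift ord0 c < shift k) && (@ord0 n.+1 < insert_cycle s (shift k)))
    = n - c)%N.
  rewrite -sum_ord_geq.
  by apply: eq_bigr => k _; rewrite insert_cycleE !shiftE /= /bump; lia.
by rewrite /= /bump /=; lia.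
Qed.

(** If [c < n], the step up from the value 0 to its successor cuts the run off. If [c = n], the
    value 0 ends the word and lengthens the run by one; the new first entry, the largest value,
    joins only when all of [s] is decreasing. *)
Lemma insert_cycle_run (s : 'S_n) : decreasing_from s c ->
  last_run (insert_cycle s)
  = if (c < n)%N then (n - c)%N
    else if last_run s == n then n.+2 else (last_run s).+1.
Proof.
move=> /decreasing_fromP dec; case: ifP => cn.
  apply: last_run_eq => [||_]; first lia.
    apply/decreasing_fromP=> i j.
    case: (insertP i) => [||i'] ->; case: (insertP j) => [||j'] ->;
      rewrite ?insert_cycleE ?ltn_shift ?shiftE /= /bump; try lia.
    by move=> ij; apply: dec; lia.
  apply/decreasing_fromP => /(_ (lift ord0 c) (shift (Ordinal cn))).
  by rewrite !insert_cycleE shiftE /= /bump; lia.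
have {cn}cn : c = n :> nat by have := ltn_ord c; lia.
case: ifP => [|full].
  rewrite last_run_full => /decreasing_fromP full; apply/eqP.
  rewrite last_run_full; apply/decreasing_fromP=> i j.
  case: (insertP i) => [||i'] ->; case: (insertP j) => [||j'] ->;
    rewrite ?insert_cycleE ?ltn_shift ?shiftE /= /bump ?cn; try lia.
  - by have := ltn_ord (s j'); lia.
  - have := ltn_ord j'; lia.
  - by move=> ij; apply: full; lia.
have Ln := last_run_leq s.
apply: last_run_eq => [||_]; first lia.
  have := leqnn (last_run s); rewrite {1}leq_last_run => /andP[_ /decreasing_fromP d].
  apply/decreasing_fromP=> i j.
  case: (insertP i) => [||i'] ->; case: (insertP j) => [||j'] ->;
    rewrite ?insert_cycleE ?ltn_shift ?shiftE /= /bump ?cn; try lia.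
  - have := ltn_ord j'; lia.
  - by move=> ij; apply: d; have := ltn_ord i'; lia.
have : ~~ (last_run s < last_run s)%N by rewrite ltnn.
rewrite {1}leq_last_run; apply: contra => /decreasing_fromP d.
apply/andP; split; first lia.
apply/decreasing_fromP=> i j ij; rewrite -ltn_shift -!insert_cycle_shift.
by apply: d; rewrite !shiftE; have := ltn_ord j; lia.
Qed.

End InsertCycle.

Lemma insert_cycle_inj (n : nat) :
  injective (fun p : 'S_n * 'I_n.+1 => insert_cycle p.2 p.1).
Proof.
move=> [s c] [t d] /= e.
have cd : c = d.
  by apply: (@lift_inj _ ord0); rewrite -(insert_cycle0 c s) e insert_cycle0.
rewrite -{d}cd in e *; congr pair; apply/permP=> k; apply: (@shift_inj _ c).
by rewrite -!insert_cycle_shift e.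
Qed.

(** If [u] sends 0 to [c + 1], it swaps the two and so permutes the other points, which form the
    range of [shift c]; [f] is the induced permutation. *)
Lemma insert_cycle_surj (n : nat) (u : 'S_n.+2) :
  involutive u -> u ord0 != ord0 -> exists c s, u = insert_cycle c s.
Proof.
move=> inv; case: (unliftP ord0 (u ord0)) => [c uc _|->]; last by rewrite eqxx.
have ushift k : exists j, u (shift c k) == shift c j.
  case: (insertP c (u (shift c k))) => [||j ->]; last by exists j.
    move/(congr1 u); rewrite inv uc => /(congr1 val); rewrite /= /bump; lia.
  by rewrite -uc => /perm_inj /(congr1 val); rewrite /= /bump; lia.
pose f k := xchoose (ushift k).
have fE k : u (shift c k) = shift c (f k) by apply/eqP/(xchooseP (ushift k)).
have f_inj : injective f.
  by move=> i j ij; apply/(@shift_inj _ c)/(@perm_inj _ u); rewrite !fE ij.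
exists c, (perm f_inj); apply/permP=> i.
case: (insertP c i) => [||k] ->; rewrite insert_cycleE //.
  by rewrite -uc inv.
by rewrite fE permE.
Qed.

(** * The 123-avoiding involution fixing the first point *)

Definition fix_reverse (n : nat) : 'S_n.+1 :=
  lift_perm ord0 ord0 (perm (@rev_ord_inj n)).

Lemma fix_reverse0 (n : nat) : fix_reverse n ord0 = ord0.
Proof. exact: lift_perm_id. Qed.

Lemma fix_reverse_lift (n : nat) (k : 'I_n) :
  fix_reverse n (lift ord0 k) = lift ord0 (rev_ord k).
Proof. by rewrite lift_perm_lift permE. Qed.

Lemma fix_reverse_decreasing (n : nat) : decreasing_from (fix_reverse n) 1.
Proof.
apply/decreasing_fromP=> i j.
case: (unliftP ord0 i) => [i'|] -> //; case: (unliftP ord0 j) => [j'|] -> //.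
by rewrite !fix_reverse_lift; case: i' j' => [x xn] [y yn] /=; rewrite /bump; lia.
Qed.

(** After a fixed first point every ascent would complete a 123, so the rest decreases; this settles
    all comparisons, hence the permutation. *)
Lemma fix_reverseP (n : nat) (s : 'S_n.+1) :
  (s \in involutions_avoiding n.+1 pattern123) && (s ord0 == ord0)
  = (s == fix_reverse n).
Proof.
rewrite inE; apply/andP/eqP => [[/andP[/involP inv /avoids123P av] /eqP s0]|->].
  have dec : decreasing_from s 1.
    apply/decreasing_fromP=> i j ij; have := av ord0 i j.
    have : s i != s j by rewrite (inj_eq perm_inj) -val_eqE /=; lia.
    have : s i != s ord0 by rewrite (inj_eq perm_inj) -val_eqE /=; lia.
    rewrite s0 -!val_eqE /=; lia.
  apply: perm_order_inj => i j.
  move/decreasing_fromP: dec => dec.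
  have /decreasing_fromP dec' := @fix_reverse_decreasing n.
  have p0 (w : 'S_n.+1) (k : 'I_n.+1) : w ord0 = ord0 -> (0 < k)%N -> (0 < w k)%N.
    move=> w0 k0; have : w k != w ord0 by rewrite (inj_eq perm_inj) -val_eqE /=; lia.
    by rewrite w0 -val_eqE /=; lia.
  have r0 := fix_reverse0 n.
  case: (ltngtP i j) => [ij|ji|/val_inj ->]; last by rewrite !ltnn.
    case: (posnP i) => [i0|i0].
      have -> : i = ord0 by apply: val_inj.
      by rewrite s0 r0 /= !p0 //; lia.
    by have := dec i j; have := dec' i j; lia.
  case: (posnP j) => [j0|j0].
    have -> : j = ord0 by apply: val_inj.
    by rewrite s0 r0.
  by have := dec j i; have := dec' j i; lia.
rewrite fix_reverse0 eqxx; split=> //; apply/andP; split.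
  apply/involP => i; case: (unliftP ord0 i) => [k|] ->; last by rewrite !fix_reverse0.
  by rewrite !fix_reverse_lift rev_ordK.
apply/avoids123P => i j k ijk.
have /decreasing_fromP/(_ j k) := @fix_reverse_decreasing n; lia.
Qed.

Lemma fix_reverse_run (n : nat) : (0 < n)%N -> last_run (fix_reverse n) = n.
Proof.
move=> n0; apply: last_run_eq => [||_]; first lia.
  by rewrite subSnn fix_reverse_decreasing.
rewrite subnn; apply/decreasing_fromP.
move=> /(_ ord0 (lift ord0 (Ordinal n0))); rewrite fix_reverse0 /= /bump; lia.
Qed.

Lemma fix_reverse_coinv (n : nat) : coinv (fix_reverse n) = n.
Proof.
rewrite coinvE big_ord_recl big_ord_recl fix_reverse0 ltnn add0n.
rewrite (eq_bigr (fun=> 1%N)); last first.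
  by move=> k _; rewrite fix_reverse_lift /= /bump.
rewrite sum1_card card_ord big1 ?addn0 // => i _; rewrite big1 // => j _.
have /decreasing_fromP h := @fix_reverse_decreasing n.
have := h (lift ord0 i) j; rewrite /= /bump; case: (ltnP _ _) => //=; lia.
Qed.

(** * Weighted sums over involutions and the telescoping argument *)

(** With a test function [g] of the last run, one insertion becomes an operator acting on [g]. *)
Definition run_sum (n : nat) (g : nat -> {poly int}) : {poly int} :=
  \sum_(s in involutions_avoiding n pattern123) 'X^(coinv s) * g (last_run s).

Lemma run_sum1 (g : nat -> {poly int}) : run_sum 1 g = g 1%N.
Proof.
have i0 (i : 'I_1) : i = ord0 by apply: ord1.
rewrite /run_sum (big_pred1 (fix_reverse 0)).
  rewrite fix_reverse_coinv mul1r; congr g.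
  by apply/eqP; rewrite last_run_full; apply/decreasing_fromP=> i j; rewrite [i]i0 [j]i0.
by move=> s; rewrite /= -fix_reverseP [s ord0]i0 eqxx andbT.
Qed.

Lemma insert_cycle_imset (n : nat) :
  [set u in involutions_avoiding n.+2 pattern123 | u ord0 != ord0]
  = (fun p : 'S_n * 'I_n.+1 => insert_cycle p.2 p.1) @:
    [set p : 'S_n * 'I_n.+1 | (p.1 \in involutions_avoiding n pattern123)
                              && decreasing_from p.1 p.2].
Proof.
apply/setP=> u; rewrite !inE; apply/idP/imsetP.
  case/andP=> /andP[/involP inv av] u0.
  have [c [s us]] := insert_cycle_surj inv u0.
  move: inv av; rewrite us => /insert_cycle_invol inv.
  rewrite insert_cycle_avoids // => av; exists (s, c) => //.
  by rewrite !inE /= -andbA av andbT; apply/involP.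
case=> -[s c]; rewrite !inE /= -andbA => /andP[/involP inv av] ->.
rewrite insert_cycle_avoids // av insert_cycle0 !andbT.
by apply/involP/insert_cycle_invol.
Qed.

Lemma sum_insert_cycle (n : nat) (s : 'S_n) (g : nat -> {poly int}) :
  \sum_(c : 'I_n.+1 | decreasing_from s c)
     'X^(coinv (insert_cycle c s)) * g (last_run (insert_cycle c s))
  = 'X^(coinv s) * (g (if last_run s == n then n.+2 else (last_run s).+1)
      + \sum_(1 <= t < (last_run s).+1) 'X^(2 * t) * g t).
Proof.
have rn := last_run_leq s.
pose h (t : nat) := 'X^(2 * t) * g (if (0 < t)%N then t
  else if last_run s == n then n.+2 else (last_run s).+1).
have -> : g (if last_run s == n then n.+2 else (last_run s).+1)
    + \sum_(1 <= t < (last_run s).+1) 'X^(2 * t) * g t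
    = \sum_(0 <= t < (last_run s).+1) h t.
  rewrite [RHS]big_ltn // /h /= expr0 mul1r; congr (_ + _).
  by rewrite !big_nat; apply: eq_bigr => t /andP[-> _].
rewrite -(@sum_ord_nat_cond _ n.+1) ?ltnS // big_distrr /=.
(* Reversal replaces the cut [c] by [t = n - c], the number of entries to the right of the inserted
   value 0. *)
rewrite (reindex_inj rev_ord_inj) /=; apply: eq_big => [t|t dt].
  by rewrite subSS leq_last_run -ltnS ltn_ord.
have tn := ltn_ord t.
rewrite insert_cycle_coinv insert_cycle_run //= subSS subKn // exprD -mulrA /h.
by have -> : (n - t < n = (0 < t))%N by lia.
Qed.

(** The isolated term is the involution fixing the first point; all others arise by exactly one
    insertion. *)
Lemma run_sum_step (n : nat) (g : nat -> {poly int}) :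
  run_sum n.+2 g
  = 'X^(n.+1) * g n.+1
    + run_sum n (fun r => g (if r == n then n.+2 else r.+1)
                          + \sum_(1 <= t < r.+1) 'X^(2 * t) * g t).
Proof.
rewrite /run_sum (bigID (fun s : 'S_n.+2 => s ord0 == ord0)) /=; congr (_ + _).
  rewrite (eq_bigl _ _ (@fix_reverseP n.+1)) big_pred1_eq.
  by rewrite fix_reverse_coinv fix_reverse_run.
rewrite (eq_bigl (mem [set u in involutions_avoiding n.+2 pattern123
                         | u ord0 != ord0])); last first.
  by move=> u; rewrite /= !inE.
rewrite insert_cycle_imset big_imset /=; last first.
  by move=> p q _ _; apply: insert_cycle_inj.
rewrite (eq_bigl (fun p : 'S_n * 'I_n.+1 =>
  (p.1 \in involutions_avoiding n pattern123) && decreasing_from p.1 p.2));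
  last by move=> p; rewrite inE.
rewrite -(pair_big_dep _ (fun s (c : 'I_n.+1) => decreasing_from s c)
  (fun s c => 'X^(coinv (insert_cycle c s)) * g (last_run (insert_cycle c s)))) /=.
by apply: eq_bigr => s _; apply: sum_insert_cycle.
Qed.

Local Notation A2 m l := (A_poly m l \Po 'X^2).
Local Notation B2 m l := (B_poly m l \Po 'X^2).

(** The substitution [t = a - 1] matches first entries [a != 1] with insertions having [t > 0]. *)
Lemma B2_succ (m l : nat) :
  B2 m.+1 l.+1 = \sum_(1 <= t < m.+1) 'X^(2 * t) * A2 t.+1 l.
Proof.
rewrite B_poly_succ big_add1 /= raddf_sum /=; apply: eq_bigr => t _.
by rewrite comp_polyM comp_Xn_poly -exprM.
Qed.

(* Contribution of the descendants, after [l] further insertions, of an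
   involution of length 2j + 1 with last run [r]. *)
Definition descendants (j l r : nat) : {poly int} :=
  if r == (2 * j).+1 then \sum_(j <= i < (j + l).+1) B2 (2 * i + 2) (j + l - i)
  else A2 r.+1 l.

(** For a last run [r] shorter than the word, [t = 0] gives [A2 r.+2 l] and [t > 0] gives
    [B2 r.+1 l.+1], which add up to [A2 r.+1 l.+1]. For a decreasing word, [t = 0] gives the sum
    from [j.+1] on and [t > 0] the missing term [i = j]. *)
Lemma run_sum_descendants (j l : nat) :
  run_sum (2 * j.+1).+1 (descendants j.+1 l)
  = 'X^(2 * j.+1) * A2 (2 * j.+1 + 1) l
    + run_sum (2 * j).+1 (descendants j l.+1).
Proof.
have -> : (2 * j.+1 = (2 * j).+2)%N by lia.
rewrite run_sum_step; congr (_ * _ + _).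
  by rewrite /descendants ifF ?addn1 //; lia.
apply: eq_bigr => s _; congr (_ * _).
have := last_run_leq s; set r := last_run s => rn.
have -> : \sum_(1 <= t < r.+1) 'X^(2 * t) * descendants j.+1 l t = B2 r.+1 l.+1.
  rewrite B2_succ !big_nat; apply: eq_bigr => t tr.
  (* Here [t <= 2 * j + 1], so [t] is never the full length [2 * j + 3]. *)
  by rewrite /descendants ifF //; lia.
rewrite {2}/descendants; case: eqP => [->|rj].
  rewrite /descendants ifT; last by lia.
  rewrite [RHS]big_ltn; last by lia.
  by rewrite addrC addKn addSnnS addn2.
rewrite /descendants ifF; last by lia.
by rewrite A_poly_succ // raddfD.
Qed.

Theorem theorem3p20 (k : nat) :
  \sum_(s in involutions_avoiding (2 * k + 1) pattern123)
     ('X^(coinv s) : {poly int})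
  = \sum_(1 <= j < k.+1) 'X^(2 * j) * (A_poly (2 * j + 1) (k - j) \Po 'X^2)
    + \sum_(0 <= j < k.+1) (B_poly (2 * j + 2) (k - j) \Po 'X^2).
Proof.
(* [m] counts the insertions already peeled off; each peeling releases the term of the involution
   fixing the first point. *)
have telescope m : (m <= k)%N ->
    run_sum (2 * k).+1 (descendants k 0)
    = \sum_((k - m).+1 <= j < k.+1) 'X^(2 * j) * A2 (2 * j + 1) (k - j)
      + run_sum (2 * (k - m)).+1 (descendants (k - m) m).
  elim: m => [_|m IH mk]; first by rewrite subn0 big_geq // add0r.
  rewrite IH; last by lia.
  have -> : (k - m = (k - m.+1).+1)%N by lia.
  rewrite run_sum_descendants [in RHS]big_ltn; last by lia.
  have -> : (k - (k - m.+1).+1 = m)%N by lia.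
  by rewrite addrA [_ * _ + _]addrC.
(* For [m = k] only length 1 is left; its single word is decreasing and yields the whole [B] sum. *)
have := telescope k (leqnn k); rewrite subnn muln0 run_sum1 {2}/descendants /=.
rewrite add0n => <-; rewrite addn1; apply: eq_bigr => s _.
(* With no insertion to come, both branches of [descendants] equal 1. *)
rewrite /descendants addn0 big_nat1 subnn A_poly0 B_poly0 comp_polyC.
by case: ifP; rewrite mulr1.
Qed.
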